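(* Let $N>1$ be an integer, let $(X,\mu)$ be a nonatomic probability space and let $\mathcal{T}$ be an $N$-homogeneous tree-like family on $X$. Let $p>1$, let $q>p$, and let $F,f>0$ be real numbers with $f^{p}\leq F$. Then $$\mathcal{B}_{p,q}^{\mathcal{T}}(F,f)\geq f^{q}+\frac{N^{q}-1}{N^{q}-N}\left(\frac{F^{\frac{q-1}{p-1}}}{f^{\frac{q-p}{p-1}}}-f^{q}\right),$$ and equality holds when $(F/f^{p})^{1/(p-1)}$ is a power of $N$; that is, if $m$ is a nonnegative integer, then $$\mathcal{B}_{p,q}^{\mathcal{T}}(N^{m(p-1)}f^{p},f)=f^{q}\left[1+\frac{N^{q}-1}{N^{q}-N}\left(N^{m(q-1)}-1\right)\right].$$
   Context: Let $(X,\mu)$ be a nonatomic probability space and $N>1$ an integer. A set $\mathcal{T}$ of measurable subsets of $X$ is called an $N$-homogeneous tree-like family if: (i) $X\in\mathcal{T}$, and to every $I\in\mathcal{T}$ there corresponds a finite subset $\mathcal{C}(I)\subseteq\mathcal{T}$ containing $N$ elements, each of measure $N^{-1}\mu(I)$, which are pairwise disjoint subsets of $I$ with $I=\bigcup\mathcal{C}(I)$; (ii) $\mathcal{T}=\bigcup_{m\geq0}\mathcal{T}_{(m)}$, where $\mathcal{T}_{(0)}=\{X\}$ and $\mathcal{T}_{(m+1)}=\bigcup_{I\in\mathcal{T}_{(m)}}\mathcal{C}(I)$; (iii) $\mathcal{T}$ differentiates $L^{1}(X,\mu)$, i.e. for every $\psi\in L^1(X,\mu)$ and $\mu$-almost every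 $x$, the averages $\frac{1}{\mu(I)}\int_I\psi\,d\mu$ over $I\in\mathcal{T}_{(m)}$ with $x\in I$ converge to $\psi(x)$ as $m\to\infty$. The associated maximal operator is $M_{\mathcal{T}}\psi(x)=\sup\left\{\frac{1}{\mu(I)}\int_{I}|\psi|\,d\mu: x\in I\in\mathcal{T}\right\}$ for $\psi\in L^{1}(X,\mu)$. Define $$\mathcal{B}_{p,q}^{\mathcal{T}}(F,f)=\inf\left\{\int_{X}(M_{\mathcal{T}}\phi)^{q}\,d\mu:\ \phi\geq0\text{ measurable},\ \int_{X}\phi\,d\mu=f,\ \int_{X}\phi^{p}\,d\mu=F\right\},$$ where individual integrals $\int_X (M_{\mathcal{T}}\phi)^q\,d\mu$ may equal $+\infty$. *)

(* Defs.v *)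
From HB Require Import structures.
From mathcomp Require Import all_boot all_order all_algebra.
From mathcomp Require Import all_classical all_reals all_analysis.

Set Implicit Arguments.
Unset Strict Implicit.
Unset Printing Implicit Defensive.

Import Order.TTheory GRing.Theory Num.Theory.
Import numFieldNormedType.Exports.

Local Open Scope classical_set_scope.
Local Open Scope ring_scope.
Local Open Scope ereal_scope.

Definition nonatomic d (X : measurableType d) (R : realType)
    (mu : probability X R) : Prop :=
  forall A, measurable A -> 0 < mu A ->
    exists B, [/\ measurable B, B `<=` A, 0 < mu B & mu B < mu A].

Definition average d (X : measurableType d) (R : realType)
    (mu : probability X R) (I : set X) (psi : X -> R) : \bar R :=
  (\int[mu]_(y in I) (psi y)%:E) / mu I.

Fixpoint tree_level (X : Type) (C : set X -> set (set X)) (m : nat) :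
    set (set X) :=
  if m is k.+1 then \bigcup_(I in tree_level C k) C I else [set setT].

(* In [tree_differentiates], [J m] is the member of the m-th level containing
   [x]; it exists and is unique by the other clauses. *)
Record tree_with_children d (X : measurableType d) (R : realType)
    (mu : probability X R) (N : nat) (T : set (set X))
    (C : set X -> set (set X)) : Prop := TreeWithChildren {
  tree_measurable : T `<=` measurable ;
  tree_setT : T setT ;
  children_tree : forall I, T I -> C I `<=` T ;
  children_card : forall I, T I -> (C I #= `I_N)%card ;
  children_measure : forall I J, T I -> C I J ->
    mu J = (N%:R^-1)%:E * mu I ;
  children_disjoint : forall I, T I -> trivIset (C I) id ;
  children_cover : forall I, T I -> I = \bigcup_(J in C I) J ;
  tree_levels : T = \bigcup_m tree_level C m ;
  tree_differentiates : forall psi : X -> R,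
    mu.-integrable setT (EFin \o psi) ->
    {ae mu, forall x, forall J : nat -> set X,
      (forall m, tree_level C m (J m) /\ J m x) ->
      average mu (J m) psi @[m --> \oo] --> (psi x)%:E} }.

Definition homogeneous_tree_like d (X : measurableType d) (R : realType)
    (mu : probability X R) (N : nat) (T : set (set X)) : Prop :=
  exists C, tree_with_children mu N T C.

Definition maximal_operator d (X : measurableType d) (R : realType)
    (mu : probability X R) (T : set (set X)) (psi : X -> R) (x : X) : \bar R :=
  ereal_sup [set average mu I (fun y => `|psi y|%R)
            | I in [set I | T I /\ I x]].

Definition Bellman d (X : measurableType d) (R : realType)
    (mu : probability X R) (T : set (set X)) (p q F f : R) : \bar R :=
  ereal_inf [set \int[mu]_x (maximal_operator mu T phi x `^ q)
            | phi in [set phi : X -> R |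
                [/\ measurable_fun setT phi, (forall x, (0 <= phi x)%R),
                    \int[mu]_x (phi x)%:E = f%:E
                  & \int[mu]_x (phi x `^ p)%:E = F%:E]]].

(* Main.v *)
Require Import Defs.
From HB Require Import structures.
From mathcomp Require Import all_boot all_order all_algebra.
From mathcomp Require Import all_classical all_reals all_analysis.
From mathcomp Require Import measurable_realfun ring lra.

Set Implicit Arguments.
Unset Strict Implicit.
Unset Printing Implicit Defensive.

Import Order.TTheory GRing.Theory Num.Theory.
Import numFieldNormedType.Exports.

Local Open Scope classical_set_scope.
Local Open Scope ring_scope.

(** Let [K] be [(N^q - 1) / (N^q - N)], [y_I] the average of [phi] over a member
    [I] of the tree, [M] the maximal function of [phi], and [Y_k] the function
    equal to [y_I] on each [I] of level [k].

    The lower bound follows the running maximum of the averages down the tree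
    with the potential [s^q - K y s^(q-1)], where [s] is the running maximum and
    [y <= s] the current average.  When one passes from a set to its children,
    [y] becomes [y_J] and [s] becomes [max s y_J].  If [y_J <= s] the potential
    changes by a multiple of [y_J - y], whose mean over the children vanishes.
    If [y_J > s], replacing [s] by [y_J] raises the potential for the value
    [y_J]: after scaling, the gain is a concave function of [y_J / s] that
    vanishes at [1] and at [N], and the ratio lies between them because
    [y_J <= N y <= N s].  This is where the homogeneity of the tree enters and
    what fixes [K] ([potential_step]).  Descending [k] levels from [X], where
    [s = y = f], gives
      [f^q + K int Y_k^q <= int M^q + K f^q]
    ([maximal_estimate_local], [maximal_estimate_avg]).  The averages converge
    to [phi] almost everywhere, so by Fatou [Y_k] may be replaced by [phi]
    ([maximal_estimate]), and interpolation between the exponents [1], [p] and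
    [q] gives [F^((q-1)/(p-1)) / f^((q-p)/(p-1)) <= int phi^q]
    ([integral_interpolation]).

    All these inequalities are sharp for a spike: take a descending chain
    [I_0, I_1, ...] with [I_k] of level [k], and let [phi] be [f N^m] on [I_m]
    and [0] elsewhere.  Each passage to a child multiplies the average by [N] or
    sends it to [0], and [phi] takes one nonzero value.  Then [M] is at most
    [f N^k] off [I_(k+1)], and summing a geometric series bounds [int M^q] by the
    value in the theorem ([integral_maximal_spike], [Bellman_power]). *)

(** * Inequalities for real powers *)

Section real_inequalities.
Context {R : realType}.
Implicit Types r q u v s y n : R.

Lemma powR_subr1 v r : 0 < v -> v `^ (r - 1) = v `^ r / v.
Proof.
move=> v0; rewrite powRB; last by apply/implyP => _; rewrite gt_eqF.
by rewrite powRr1// ltW.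
Qed.

(** The convex function [u ^ r] lies above its tangent at [v]; this is Young's
    inequality for [u] and [v ^ (r - 1)]. *)
Lemma powR_tangent r u v : 1 < r -> 0 <= u -> 0 < v ->
  r * v `^ (r - 1) * u - (r - 1) * v `^ r <= u `^ r.
Proof.
move=> r1 u0 v0.
have r0 : 0 < r by lra.
have r10 : 0 < r - 1 by lra.
have := @conjugate_powR R u (v `^ (r - 1)) r (r / (r - 1)) u0 (powR_ge0 _ _) r0.
rewrite divr_gt0// => /(_ isT).
have -> : r^-1 + (r / (r - 1))^-1 = 1 by field; rewrite !gt_eqF.
move=> /(_ erefl).
have -> : (v `^ (r - 1)) `^ (r / (r - 1)) = v `^ r.
  by rewrite -powRrM; congr (_ `^ _); field; rewrite gt_eqF.
move=> /(ler_wpM2l (ltW r0)) H.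
have E : r * (u `^ r / r + v `^ r / (r / (r - 1))) = u `^ r + (r - 1) * v `^ r.
  by field; rewrite !gt_eqF.
rewrite E in H.
lra.
Qed.

(** A weighted sum of the bounds that the tangent at [s] gives at the two
    endpoints [1] and [n]. *)
Lemma powR_chord q n s : 1 < q -> 1 <= s -> s <= n ->
  (n - 1) * s `^ q <= (n - s) + (s - 1) * n `^ q.
Proof.
move=> q1 s1 sn.
have s0 : 0 < s by lra.
have T1 := powR_tangent q1 ler01 s0.
have Tn := @powR_tangent q n s q1 (le_trans (ltW s0) sn) s0.
rewrite powR1 in T1.
have sE : s * s `^ (q - 1) = s `^ q by rewrite mulr_powRB1//; lra.
have ns : 0 <= n - s by lra.
have s10 : 0 <= s - 1 by lra.
have := lerD (ler_wpM2l ns T1) (ler_wpM2l s10 Tn).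
rewrite -sE; set a := s `^ (q - 1); set b := n `^ q => H.
lra.
Qed.

Definition extremal_const q n := (n `^ q - 1) / (n `^ q - n).

Lemma ltr_powR_self q n : 1 < q -> 1 < n -> n < n `^ q.
Proof.
move=> q1 n1; rewrite -[ltLHS]powRr1; last lra.
by rewrite /powR gt_eqF ?ltr_expR; [rewrite ltr_pM2r// ln_gt0|lra].
Qed.

Lemma extremal_const_gt0 q n : 1 < q -> 1 < n -> 0 < extremal_const q n.
Proof.
move=> q1 n1; have nq := ltr_powR_self q1 n1.
by rewrite divr_gt0// subr_gt0// (lt_trans n1).
Qed.

(** The potential [s ^ q - K * y * s ^ (q - 1)] does not decrease when a new
    average [y] updates the running maximum [s]; subtractions are moved across so
    that both sides integrate as nonnegative functions. *)
Definition potential_const q n K := forall s y,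
  0 < s -> 0 <= y -> y <= n * s ->
  s `^ q + K * Num.max s y `^ (q - 1) * y
  <= Num.max s y `^ q + K * s `^ (q - 1) * y.

(** For [y > s] and [u = y / s] the claim reads
    [(K - 1) * u ^ q <= K * u - 1]: the value of [K] makes the right-hand side
    the multiple by [K - 1] of the chord of [u ^ q] over the interval from [1] to
    [n]. *)
Lemma potential_step q n : 1 < q -> 1 < n ->
  potential_const q n (extremal_const q n).
Proof.
move=> q1 n1 s y s0 y0 yns; set K := extremal_const q n.
have [//|sy] := leP y s.
have yp : 0 < y := lt_trans s0 sy.
have nq := ltr_powR_self q1 n1.
have Kq : K * (n `^ q - n) = n `^ q - 1.
  by rewrite /K /extremal_const -mulrA mulVf ?mulr1// gt_eqF// subr_gt0.
move: K Kq => K Kq.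
have u1 : 1 <= y / s by rewrite ler_pdivlMr// mul1r ltW.
have un : y / s <= n by rewrite ler_pdivrMr.
(* The claim is homogeneous of degree [q] in [s] and [y]; divide by [s ^ q]. *)
have := powR_chord q1 u1 un.
have -> : y `^ q = (y / s) `^ q * s `^ q.
  by rewrite -powRM ?divr_ge0 ?(ltW s0)// divfK// gt_eqF.
have sE : s `^ (q - 1) = s `^ q / s by rewrite powR_subr1.
have yE : y `^ (q - 1) * y = (y / s) `^ q * s `^ q.
  rewrite mulrC mulr_powRB1//; last lra.
  by rewrite -powRM ?divr_ge0 ?(ltW s0)// divfK// gt_eqF.
rewrite -!mulrA yE sE.
have -> : s `^ q / s * y = s `^ q * (y / s) by ring.
have sq0 : 0 < s `^ q by rewrite powR_gt0.
move: (s `^ q) sq0 (y / s) u1 un => S S0 u u1 un.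
move: ((u : R) `^ q) => U H.
have key : (K - 1) * U <= K * u - 1.
  have d0 : 0 < n `^ q - n by lra.
  rewrite -(ler_pM2l d0).
  have -> : (n `^ q - n) * ((K - 1) * U) = (n - 1) * U.
    by rewrite mulrA mulrBr mulr1 [X in X - _]mulrC Kq; ring.
  have -> : (n `^ q - n) * (K * u - 1) = (n - u) + (u - 1) * n `^ q.
    by rewrite mulrBr mulrA [X in X * u]mulrC Kq; ring.
  exact: H.
have := ler_wpM2r (ltW S0) key.
lra.
Qed.

End real_inequalities.

(** * Levels and cells of the tree *)


Section tree_structure.
Context d (X : measurableType d) (R : realType) (mu : probability X R).
Context (N : nat) (T : set (set X)) (C : set X -> set (set X)).
Context (N_gt1 : (1 < N)%N) (treeT : tree_with_children mu N T C).

Lemma level_sub_tree m I : tree_level C m I -> T I.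
Proof. by move=> mI; rewrite (tree_levels treeT); exists m. Qed.

Lemma tree_has_level I : T I -> exists m, tree_level C m I.
Proof. by rewrite {1}(tree_levels treeT) => -[m _ mI]; exists m. Qed.

Lemma level_measurable m I : tree_level C m I -> measurable I.
Proof. by move=> /level_sub_tree; exact: tree_measurable treeT _. Qed.

Lemma level_child m I J : tree_level C m I -> C I J -> tree_level C m.+1 J.
Proof. by move=> mI IJ; exists I. Qed.

Lemma child_sub I J : T I -> C I J -> J `<=` I.
Proof. by move=> TI IJ x Jx; rewrite (children_cover treeT TI); exists J. Qed.

Lemma mu_level m I : tree_level C m I -> mu I = (N%:R ^- m)%:E.
Proof.
elim: m I => [I /= -> |m IH J [I mI IJ]].
  by rewrite probability_setT expr0 invr1.
rewrite (children_measure treeT (level_sub_tree mI) IJ) (IH _ mI) -EFinM.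
by rewrite exprS invfM.
Qed.

Lemma mu_level_gt0 m : 0 < N%:R ^- m :> R.
Proof. by rewrite invr_gt0 exprn_gt0// ltr0n; exact: ltn_trans N_gt1. Qed.

(** Enumerating the children by [nat], with the empty set past the last one, puts
    the decomposition of [I] in the shape required by additivity of the
    integral. *)
Lemma children_enum I : T I -> exists e : nat -> set X,
  [/\ forall i, C I (e i) \/ e i = set0,
      trivIset setT e
    & I = \big[setU/set0]_(i <- index_iota 0 N) e i].
Proof.
move=> TI; have := children_card treeT TI; rewrite card_eq_sym.
move=> /card_set_bijP[e [eC einj esurj]].
pose e' i := if (i < N)%N then e i else set0.
exists e'; rewrite /e'; split.
- by move=> i; case: ifPn => iN; [left; exact: eC|right].
- move=> i j _ _ [x []]; case: ifPn => // iN ix; case: ifPn => // jN jx.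
  apply: einj; rewrite ?inE//.
  by apply: (children_disjoint treeT TI) => //; [exact: eC|exact: eC|exists x].
- rewrite big_mkord -(bigcup_mkord _ e') {1}(children_cover treeT TI).
  rewrite -(surj_image_eq _ esurj) ?bigcup_image//.
    by apply: eq_bigcupr => i /= iN; rewrite /e' iN.
  by move=> _ [i iN <-]; exact: eC.
Qed.

Lemma children_finite I : T I -> finite_set (C I).
Proof. by move=> TI; exists N; exact: children_card treeT _ TI. Qed.

Lemma level_finite m : finite_set (tree_level C m).
Proof.
elim: m => [|m IH] /=; first exact: finite_set1.
by apply: bigcup_finite => // I /level_sub_tree; exact: children_finite.
Qed.

Lemma level_disjoint m I J x :
  tree_level C m I -> tree_level C m J -> I x -> J x -> I = J.
Proof.
elim: m I J => [I J /= -> -> //|m IH I J [I' mI' I'I] [J' mJ' J'J] Ix Jx].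
have TI' := level_sub_tree mI'; have TJ' := level_sub_tree mJ'.
have E : I' = J'.
  by apply: IH mI' mJ' _ _; [exact: child_sub I'I _ Ix|exact: child_sub J'J _ Jx].
move: J'J; rewrite -E => J'J.
by apply: (children_disjoint treeT TI') => //; exists x.
Qed.

Lemma level_cover m x : exists I, tree_level C m I /\ I x.
Proof.
elim: m => [|m [I [mI Ix]]]; first by exists setT.
have := Ix; rewrite (children_cover treeT (level_sub_tree mI)) => -[J IJ Jx].
by exists J; split => //; exists I.
Qed.

(** The default [set0] is never taken, by [level_cover]. *)
Definition cell m x := xget set0 [set I | tree_level C m I /\ I x].

Lemma cellP m x : tree_level C m (cell m x) /\ cell m x x.
Proof.
have [I mIx] := level_cover m x.
exact: (@xgetPex _ set0 [set I | tree_level C m I /\ I x]) (ex_intro _ I mIx).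
Qed.

Lemma cellE m I x : tree_level C m I -> I x -> cell m x = I.
Proof.
by move=> mI Ix; have [mJ Jx] := cellP m x; exact: level_disjoint mJ mI Jx Ix.
Qed.

(** By [level_disjoint], a set of level [m + k] that meets [I] descends from
    [I]. *)
Lemma level_sub_ancestor m k I J x : tree_level C m I ->
  tree_level C (m + k) J -> I x -> J x -> J `<=` I.
Proof.
move=> mI; elim: k J => [J|k IH J].
  by rewrite addn0 => mJ Ix Jx; rewrite (level_disjoint mI mJ Ix Jx).
rewrite addnS => -[J' mJ' J'J] Ix Jx.
have JJ' := child_sub (level_sub_tree mJ') J'J.
exact: subset_trans JJ' (IH _ mJ' Ix (JJ' _ Jx)).
Qed.

(** Such a function is constant on each of the finitely many members of level
    [m], so that its preimages are finite unions of them. *)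
Lemma measurable_fun_cell m d' (U : measurableType d') (g : set X -> U) :
  measurable_fun setT (fun x => g (cell m x)).
Proof.
move=> _ A mA; rewrite setTI.
rewrite (_ : _ @^-1` A = \bigcup_(I in tree_level C m `&` (g @^-1` A)) I).
  apply: fin_bigcup_measurable.
    by apply: sub_finite_set (level_finite m) => I [].
  by move=> I [mI _]; exact: level_measurable mI.
apply/seteqP; split => [x /= gA|x [I [mI /= gA] Ix] /=].
  by have [mJ Jx] := cellP m x; exists (cell m x).
by rewrite (cellE mI Ix).
Qed.

Lemma le_integral_children I (g h : X -> \bar R) : T I ->
    measurable_fun setT g -> measurable_fun setT h ->
    (forall x, 0 <= g x)%E -> (forall x, 0 <= h x)%E ->
    (forall J, C I J -> \int[mu]_(x in J) g x <= \int[mu]_(x in J) h x)%E ->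
  (\int[mu]_(x in I) g x <= \int[mu]_(x in I) h x)%E.
Proof.
move=> TI mg mh g0 h0 gh; have [e [eC etriv ->]] := children_enum TI.
have me i : measurable (e i).
  have [eiC|->//] := eC i.
  exact: (tree_measurable treeT (children_tree treeT TI eiC)).
rewrite !ge0_integral_bigsetU ?iota_uniq//; last 4 first.
- exact: sub_trivIset etriv.
- exact: measurable_funS mh.
- exact: sub_trivIset etriv.
- exact: measurable_funS mg.
apply: lee_sum => i _; have [/gh//|->] := eC i.
by rewrite !integral_set0.
Qed.

End tree_structure.

(** * Averages and the maximal function *)


Section averages.
Context d (X : measurableType d) (R : realType) (mu : probability X R).
Context (N : nat) (T : set (set X)) (C : set X -> set (set X)).
Context (N_gt1 : (1 < N)%N) (treeT : tree_with_children mu N T C).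
Context (phi : X -> R) (f : R).
Context (mphi : measurable_fun setT phi) (phi0 : forall x, 0 <= phi x).
Context (int_phi : (\int[mu]_x (phi x)%:E)%E = f%:E).

Local Notation level := (tree_level C).
Local Notation cell := (cell C).
Local Notation M := (maximal_operator mu T phi).

Lemma measurable_EFin_phi D : measurable_fun D (EFin \o phi).
Proof. by apply/measurable_EFinP; exact: measurable_funS mphi. Qed.

Lemma integral_phi_le I : measurable I ->
  (\int[mu]_(x in I) (phi x)%:E <= f%:E)%E.
Proof.
move=> mI; rewrite -int_phi; apply: ge0_subset_integral => //.
- exact: measurable_EFin_phi.
- by move=> x _; rewrite lee_fin.
Qed.

Lemma integral_phi_fin I : measurable I ->
  (\int[mu]_(x in I) (phi x)%:E)%E \is a fin_num.
Proof.
move=> mI; rewrite ge0_fin_numE; last first.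
  by apply: integral_ge0 => x _; rewrite lee_fin.
exact: le_lt_trans (integral_phi_le mI) (ltry _).
Qed.

Lemma integral_cst_level m I (c : R) : level m I ->
  (\int[mu]_(x in I) cst c%:E x)%E = (N%:R ^- m * c)%:E.
Proof.
move=> mI; rewrite integral_cst; last exact: level_measurable treeT _ _ mI.
by rewrite mulrC EFinM -(mu_level treeT mI).
Qed.

Definition avg I : R := fine (average mu I phi).

Lemma averageE m I : level m I ->
  average mu I phi = (N%:R ^+ m * fine (\int[mu]_(x in I) (phi x)%:E)%E)%:E.
Proof.
move=> mI; have N0 := @mu_level_gt0 R N N_gt1 m.
rewrite /average (mu_level treeT mI) inver gt_eqF// invrK.
by rewrite -{1}(fineK (integral_phi_fin (level_measurable treeT mI))) muleC.
Qed.

Lemma average_avg m I : level m I -> average mu I phi = (avg I)%:E.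
Proof. by move=> mI; rewrite /avg (averageE mI). Qed.

Lemma integral_avg m I : level m I ->
  (\int[mu]_(x in I) (phi x)%:E)%E = (N%:R ^- m * avg I)%:E.
Proof.
move=> mI; rewrite /avg (averageE mI) /= mulKf.
  by rewrite fineK// integral_phi_fin//; exact: level_measurable treeT _ _ mI.
by have := @mu_level_gt0 R N N_gt1 m; rewrite invr_gt0 => /gt_eqF ->.
Qed.

Lemma avg_ge0 I : 0 <= avg I.
Proof.
rewrite /avg fine_ge0// /average mule_ge0// ?inve_ge0//.
by apply: integral_ge0 => x _; rewrite lee_fin.
Qed.

(** A child carries a fraction [1 / N] of the measure of its parent and at most
    all of its mass. *)
Lemma avg_child m I J : level m I -> C I J -> avg J <= N%:R * avg I.
Proof.
move=> mI IJ; have mJ := level_child mI IJ.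
have N0 : 0 < N%:R :> R by rewrite ltr0n; exact: ltn_trans N_gt1.
rewrite -(ler_pM2l (@mu_level_gt0 R N N_gt1 m.+1)) -lee_fin -(integral_avg mJ).
have -> : N%:R ^- m.+1 * (N%:R * avg I) = N%:R ^- m * avg I.
  by rewrite exprS invfM mulrA [_ * N%:R]mulrC mulrA mulfV ?mul1r// gt_eqF.
rewrite -(integral_avg mI); apply: ge0_subset_integral.
- exact: level_measurable treeT _ _ mJ.
- exact: level_measurable treeT _ _ mI.
- exact: measurable_EFin_phi.
- by move=> x _; rewrite lee_fin.
- exact: (child_sub treeT (level_sub_tree treeT mI) IJ).
Qed.

Lemma avg_setT : avg setT = f.
Proof.
have := @integral_avg 0 setT erefl; rewrite int_phi expr0 invr1 mul1r.
by move=> [].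
Qed.

(** Exactly one set of each level contains [x]; the supremum over the tree is
    thus a countable one, which makes it measurable. *)
Lemma maximal_operatorE x : M x = ereal_sup (range (fun m => (avg (cell m x))%:E)).
Proof.
rewrite /maximal_operator.
have -> : (fun y => `|phi y|) = phi by apply/funext => y; rewrite ger0_norm.
congr ereal_sup; apply/seteqP; split => [_ [I [TI Ix] <-]|_ [m _ <-]].
  have [m mI] := tree_has_level treeT TI.
  by exists m => //; rewrite (cellE treeT mI Ix) (average_avg mI).
have [mI Ix] := cellP treeT m x.
by exists (cell m x); [split => //; exact: level_sub_tree treeT _ _ mI|
                       rewrite (average_avg mI)].
Qed.

Lemma avg_le_maximal m I x : level m I -> I x -> ((avg I)%:E <= M x)%E.
Proof.
move=> mI Ix; rewrite maximal_operatorE; apply: ereal_sup_ubound.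
by exists m => //; rewrite (cellE treeT mI Ix).
Qed.

Lemma maximal_ge x : (f%:E <= M x)%E.
Proof. by rewrite -avg_setT; exact: (@avg_le_maximal 0). Qed.

Lemma maximal_measurable : measurable_fun setT M.
Proof.
have -> : M = (fun x => esups (fun m => (avg (cell m x))%:E) 0).
  apply/funext => x; rewrite maximal_operatorE /esups /=; congr ereal_sup.
  by apply/seteqP; split => _ [m _ <-]; exists m.
apply: measurable_fun_esups => m.
exact: (measurable_fun_cell treeT m (fun I => (avg I)%:E)).
Qed.

End averages.

(** * The potential estimate along the tree *)


Section lower_bound.
Context d (X : measurableType d) (R : realType) (mu : probability X R).
Context (N : nat) (T : set (set X)) (C : set X -> set (set X)).
Context (N_gt1 : (1 < N)%N) (treeT : tree_with_children mu N T C).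
Context (phi : X -> R) (f q : R).
Context (mphi : measurable_fun setT phi) (phi0 : forall x, 0 <= phi x).
Context (int_phi : (\int[mu]_x (phi x)%:E)%E = f%:E).
Context (q_gt1 : 1 < q) (K : R) (K_gt0 : 0 < K).
Context (K_step : potential_const q N%:R K).

Local Notation level := (tree_level C).
Local Notation cell := (cell C).
Local Notation M := (maximal_operator mu T phi).
Local Notation avg := (avg mu phi).

Let mavg k : measurable_fun setT (fun x => ((avg (cell k x)) `^ q)%:E).
Proof. exact: (measurable_fun_cell treeT k (fun I => (avg I `^ q)%:E)). Qed.

Let mmax s : measurable_fun setT (fun x => (maxe s%:E (M x) `^ q)%E).
Proof.
apply: (measurableT_comp (measurable_poweR q)).
apply: measurable_maxe => //.
exact: (maximal_measurable N_gt1 treeT mphi phi0 int_phi).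
Qed.

Let mscale (k : R) (g : X -> R) : measurable_fun setT (EFin \o g) ->
  measurable_fun setT (fun x => (k * g x)%:E).
Proof.
move=> /measurable_EFinP mg; apply/measurable_EFinP.
exact: measurable_funM.
Qed.

Lemma integral_avg_side k J (c : R) : measurable J -> 0 <= c ->
  (\int[mu]_(x in J) (c + K * avg (cell k x) `^ q)%:E =
   c%:E * mu J + K%:E * \int[mu]_(x in J) (avg (cell k x) `^ q)%:E)%E.
Proof.
move=> mJ c0; have K0 := ltW K_gt0.
under eq_integral do rewrite EFinD.
rewrite ge0_integralD//; last 2 first.
- by move=> x _; rewrite lee_fin mulr_ge0// powR_ge0.
- apply: (@measurable_funS _ _ _ _ setT) => //; apply: mscale; exact: mavg.
- rewrite integral_cst//; congr (_ + _)%E.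
  under eq_integral do rewrite EFinM.
  rewrite ge0_integralZl//.
  + exact: measurable_funS (mavg k).
  + by move=> x _; rewrite lee_fin powR_ge0.
Qed.

Lemma integral_max_side s J (c : R) : measurable J -> 0 <= c ->
  (\int[mu]_(x in J) (maxe s%:E (M x) `^ q + (c * phi x)%:E) =
   \int[mu]_(x in J) (maxe s%:E (M x) `^ q) +
   c%:E * \int[mu]_(x in J) (phi x)%:E)%E.
Proof.
move=> mJ c0; rewrite ge0_integralD//; last 4 first.
- by move=> x _; rewrite poweR_ge0.
- exact: measurable_funS (mmax s).
- by move=> x _; rewrite lee_fin mulr_ge0// powR_ge0.
- apply: (@measurable_funS _ _ _ _ setT) => //; apply: mscale.
  exact/measurable_EFinP.
congr (_ + _)%E; under eq_integral do rewrite EFinM.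
rewrite ge0_integralZl//.
- by apply: (@measurable_funS _ _ _ _ setT) => //; exact/measurable_EFinP.
- by move=> x _; rewrite lee_fin.
Qed.

(** Both sides are integrals over [I], so that the induction on the depth [k]
    can be carried out child by child.  A child [J] is treated with
    [t = max s (avg J)] in place of [s]: on [J] the function [M] is at least
    [avg J], hence [max t M = max s M], and the change from [s] to [t] in the
    remaining terms is [potential_const]. *)
Lemma maximal_estimate_local k m I s : level m I -> 0 < s -> avg I <= s ->
  (\int[mu]_(x in I) (s `^ q + K * avg (cell (m + k) x) `^ q)%:E <=
   \int[mu]_(x in I) (maxe s%:E (M x) `^ q + (K * s `^ (q - 1) * phi x)%:E))%E.
Proof.
have K0 := K_gt0.
have q0 : 0 < q := lt_trans ltr01 q_gt1.
elim: k m I s => [|k IH] m I s mI s0 Is.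
  (* Here [M] only enters by [max s M >= s], and [Y ^ q <= s ^ (q - 1) * Y]. *)
  have mIs := level_measurable treeT mI.
  rewrite integral_avg_side ?powR_ge0// integral_max_side//; last first.
    by rewrite mulr_ge0 ?powR_ge0// ltW.
  apply: leeD.
    rewrite -integral_cst//; apply: ge0_le_integral => //.
    - by move=> x _; rewrite lee_fin powR_ge0.
    - exact: measurable_funS (mmax s).
    - move=> x _; rewrite -poweR_EFin gt0_ler_poweR ?(ltW q0)//.
      + by rewrite in_itv/= leey lee_fin ltW.
      + by rewrite in_itv/= leey le_max lee_fin ltW.
      + by rewrite le_max lexx.
  rewrite (integral_avg N_gt1 treeT mphi phi0 int_phi mI) addn0.
  have -> : (\int[mu]_(x in I) (avg (cell m x) `^ q)%:E =
             \int[mu]_(x in I) cst (avg I `^ q)%:E x)%E.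
    by apply: eq_integral => x; rewrite inE => Ix; rewrite (cellE treeT mI Ix).
  rewrite (integral_cst_level treeT _ mI) -!EFinM lee_fin.
  rewrite -mulrA; apply: ler_wpM2l; first exact: ltW.
  rewrite [leRHS]mulrCA; apply: ler_wpM2l; first exact/ltW/mu_level_gt0.
  rewrite -mulr_powRB1 ?avg_ge0// mulrC; apply: ler_wpM2r; rewrite ?avg_ge0//.
  by rewrite ge0_ler_powR ?nnegrE ?avg_ge0 ?(ltW s0)// subr_ge0 ltW.
apply: (le_integral_children treeT (level_sub_tree treeT mI)).
- apply/measurable_EFinP; apply: measurable_funD => //.
  by apply/measurable_EFinP; apply: mscale; exact: mavg.
- apply: emeasurable_funD => //; apply: mscale; exact/measurable_EFinP.
- by move=> x; rewrite lee_fin addr_ge0// ?mulr_ge0 ?powR_ge0// ltW.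
- move=> x; rewrite adde_ge0 ?poweR_ge0// lee_fin.
  by rewrite !mulr_ge0 ?powR_ge0// ltW.
move=> J IJ; have mJ := level_child mI IJ.
have mJs := level_measurable treeT mJ.
pose t := Num.max s (avg J).
have t0 : 0 < t by rewrite lt_max s0.
have Jt : avg J <= t by rewrite le_max lexx orbT.
have := IH _ _ _ mJ t0 Jt; rewrite addSnnS.
have Kpow v : 0 <= K * v `^ (q - 1) by rewrite mulr_ge0 ?powR_ge0// ltW.
rewrite (integral_avg_side _ mJs (powR_ge0 t q)).
rewrite (integral_avg_side _ mJs (powR_ge0 s q)).
rewrite (integral_max_side t mJs (Kpow t)) (integral_max_side s mJs (Kpow s)).
have -> : (\int[mu]_(x in J) (maxe t%:E (M x) `^ q) =
           \int[mu]_(x in J) (maxe s%:E (M x) `^ q))%E.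
  apply: eq_integral => x; rewrite inE => Jx; congr (_ `^ _)%E.
  rewrite /t EFin_max -maxA; congr maxe; apply/max_idPr.
  exact: (avg_le_maximal N_gt1 treeT mphi phi0 int_phi mJ).
(* Only these two integrals may be infinite. *)
have A0 : (0 <= \int[mu]_(x in J) (maxe s%:E (M x) `^ q))%E.
  by apply: integral_ge0 => x _; exact: poweR_ge0.
have B0 : (0 <= \int[mu]_(x in J) (avg (cell (m + k.+1) x) `^ q)%:E)%E.
  by apply: integral_ge0 => x _; rewrite lee_fin powR_ge0.
move: A0 B0; move: (\int[mu]_(x in J) _)%E => A.
move: (\int[mu]_(x in J) (avg _ `^ q)%:E)%E => B.
rewrite (integral_avg N_gt1 treeT mphi phi0 int_phi mJ) (mu_level treeT mJ).
have step := K_step s0 (avg_ge0 _ phi0 _)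
  (le_trans (avg_child N_gt1 treeT mphi phi0 int_phi mI IJ)
     (ler_wpM2l (ler0n _ _) Is)).
move: A B => [A| |] [B| |] // _ _; rewrite -?EFinM -?EFinD ?lee_fin.
- rewrite -/t in step => H.
  have := ler_wpM2l (ltW (@mu_level_gt0 R N N_gt1 m.+1)) step.
  move: H; set a := N%:R ^- m.+1; lra.
- by rewrite gt0_muley ?lte_fin// !addey// leye_eq.
- by rewrite !addye// !leey.
- by rewrite !addye// !leey.
Qed.

Lemma maximal_estimate_avg k : 0 < f ->
  ((f `^ q)%:E + K%:E * \int[mu]_x (avg (cell k x) `^ q)%:E <=
   \int[mu]_x (M x `^ q) + (K * f `^ q)%:E)%E.
Proof.
move=> f0; have K0 := K_gt0.
have := @maximal_estimate_local k 0 setT f erefl f0.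
rewrite (avg_setT N_gt1 treeT mphi phi0 int_phi) lexx => /(_ isT).
rewrite add0n integral_avg_side ?powR_ge0// integral_max_side//; last first.
  by rewrite mulr_ge0 ?powR_ge0// ltW.
rewrite probability_setT mule1 int_phi -EFinM -mulrA.
rewrite [_ `^ (q - 1) * f]mulrC mulr_powRB1 ?(ltW f0)//; last exact: lt_trans ltr01 q_gt1.
under [X in (_ <= X + _)%E -> _]eq_integral.
  move=> x _; rewrite (_ : maxe _ _ = M x); last first.
    by apply/max_idPr; exact: (maximal_ge N_gt1 treeT mphi phi0 int_phi).
  over.
by [].
Qed.

End lower_bound.

(** * Passage to the limit *)


Lemma cvg_powR (R : realType) (q v : R) (u : R^nat) : 1 < q -> 0 <= v ->
  (forall n, 0 <= u n) -> u n @[n --> \oo] --> v ->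
  u n `^ q @[n --> \oo] --> v `^ q.
Proof.
move=> q1 v0 u0 uv; have q0 : 0 < q := lt_trans ltr01 q1.
move: v0; rewrite le_eqVlt => /predU1P[v0|v0].
- rewrite -v0 in uv *; rewrite powR0 ?gt_eqF//.
  apply: (squeeze_cvgr _ (cvg_cst 0) uv).
  have : \forall n \near \oo, u n < 1 by apply: cvgr_lt uv _ ltr01.
  apply: filterS => n un1; rewrite powR_ge0/=.
  have := u0 n; rewrite le_eqVlt => /predU1P[<-|un0].
    by rewrite powR0 ?gt_eqF.
  by rewrite ge1r_powR// ?un0/= ltW.
- have cont : {for v, continuous (@powR R ^~ q)}.
    apply: differentiable_continuous; apply/derivable1_diffP.
    by apply: derivable_powR; rewrite in_itv/= v0.
  exact: (continuous_cvg _ cont uv).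
Qed.

Lemma limn_einf_le (R : realType) (u : (\bar R)^nat) (l : \bar R) :
  (forall n, u n <= l)%E -> (limn_einf u <= l)%E.
Proof.
move=> ul; rewrite limn_einf_lim; apply: lime_le; first exact: is_cvg_einfs.
near=> n; apply: le_trans (ul n); apply: ereal_inf_lbound.
by exists n => /=.
Unshelve. all: by end_near. Qed.

Section maximal_lower_bound.
Context d (X : measurableType d) (R : realType) (mu : probability X R).
Context (N : nat) (T : set (set X)) (C : set X -> set (set X)).
Context (N_gt1 : (1 < N)%N) (treeT : tree_with_children mu N T C).
Context (phi : X -> R) (f q : R).
Context (mphi : measurable_fun setT phi) (phi0 : forall x, 0 <= phi x).
Context (int_phi : (\int[mu]_x (phi x)%:E)%E = f%:E).
Context (q_gt1 : 1 < q).

Local Notation avg := (avg mu phi).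
Local Notation M := (maximal_operator mu T phi).

Lemma cvg_avg : {ae mu, forall x,
  avg (cell C m x) @[m --> \oo] --> phi x}.
Proof.
have iphi : mu.-integrable setT (EFin \o phi).
  apply/integrableP; split; first exact/measurable_EFinP.
  under eq_integral => x _ do rewrite /= ger0_norm//.
  by rewrite int_phi ltry.
have := tree_differentiates treeT iphi.
apply: filterS => x /(_ (fun m => cell C m x) (fun m => cellP treeT m x)).
by move=> /fine_cvgP[_].
Qed.

(** Fatou's lemma for the averages over the cells of level [k]. *)
Lemma integral_powR_le B :
  (forall k, \int[mu]_x (avg (cell C k x) `^ q)%:E <= B)%E ->
  (\int[mu]_x (phi x `^ q)%:E <= B)%E.
Proof.
move=> avgB; pose u n x : \bar R := (avg (cell C n x) `^ q)%:E.
have mu_ n : measurable_fun setT (u n).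
  exact: (measurable_fun_cell treeT n (fun I => (avg I `^ q)%:E)).
have u0 n x : setT x -> (0 <= u n x)%E by move=> _; rewrite lee_fin powR_ge0.
apply: le_trans (limn_einf_le avgB).
apply: le_trans (fatou mu measurableT mu_ u0).
apply: ae_ge0_le_integral => //.
- by move=> x _; rewrite lee_fin powR_ge0.
- apply/measurable_EFinP; exact: (measurableT_comp (measurable_powR q)).
- move=> x _; rewrite limn_einf_lim; apply: lime_ge; first exact: is_cvg_einfs.
  by apply: nearW => n; apply: le_ereal_inf_tmp => _ [k _ <-]; exact: u0.
- rewrite /limn_einf; apply: measurableT_comp => //.
  by apply: measurable_fun_limn_esup => n; exact: measurableT_comp.
- have := cvg_avg; apply: filterS => x ax _.
  have : u n x @[n --> \oo] --> (phi x `^ q)%:E.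
    apply: cvg_EFin; first exact: nearW.
    by apply: cvg_powR => // n; exact: avg_ge0.
  by move=> /cvg_limn_einf_sup[-> _].
Qed.

(** The bound of [maximal_estimate_avg] is solved for [int Y_k^q], which is
    possible when [int M^q] is finite, before [integral_powR_le] is applied. *)
Lemma maximal_estimate (K : R) : 0 < K -> potential_const q N%:R K -> 0 < f ->
  ((f `^ q)%:E + K%:E * \int[mu]_x (phi x `^ q)%:E
   <= \int[mu]_x (M x `^ q) + (K * f `^ q)%:E)%E.
Proof.
move=> K0 Kstep f0.
have est := maximal_estimate_avg N_gt1 treeT mphi phi0 int_phi q_gt1 K0 Kstep.
have := fun k => est k f0; have := @integral_powR_le.
have : (0 <= \int[mu]_x (M x `^ q))%E.
  by apply: integral_ge0 => x _; exact: poweR_ge0.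
move: (\int[mu]_x (M x `^ q))%E => [W| |]// _ Ble Eavg; last first.
  by rewrite addye// leey.
have : (\int[mu]_x (phi x `^ q)%:E <= ((W + K * f `^ q - f `^ q) / K)%:E)%E.
  apply: Ble => // k; have := Eavg k.
  have : (0 <= \int[mu]_x (avg (cell C k x) `^ q)%:E)%E.
    by apply: integral_ge0 => x _; rewrite lee_fin powR_ge0.
  case: (\int[mu]_x _)%E => [B| |]// _; last by rewrite gt0_muley ?lte_fin.
  by rewrite -EFinM -!EFinD !lee_fin ler_pdivlMr//; lra.
have : (0 <= \int[mu]_x (phi x `^ q)%:E)%E.
  by apply: integral_ge0 => x _; rewrite lee_fin powR_ge0.
case: (\int[mu]_x _)%E => [B| |]// _.
by rewrite -EFinM -!EFinD !lee_fin ler_pdivlMr//; lra.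
Qed.

End maximal_lower_bound.

(** * Interpolation between exponents and the lower bound *)


Section interpolation.
Context d (X : measurableType d) (R : realType) (mu : probability X R).
Context (phi : X -> R) (p q F f : R).
Context (mphi : measurable_fun setT phi) (phi0 : forall x, 0 <= phi x).
Context (int_phi : (\int[mu]_x (phi x)%:E)%E = f%:E).
Context (int_phip : (\int[mu]_x (phi x `^ p)%:E)%E = F%:E).
Context (p_gt1 : 1 < p) (pq : p < q) (F_gt0 : 0 < F) (f_gt0 : 0 < f).

(** The tangent inequality for the exponent [r], at [a ^ (p - 1)], multiplied by
    [a]. *)
Lemma powR_interpolation (a v : R) (r := (q - 1) / (p - 1)) :
  0 <= a -> 0 < v ->
  (r * v `^ (r - 1)) * a `^ p <= a `^ q + ((r - 1) * v `^ r) * a.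
Proof.
have [p1 pq'] := (p_gt1, pq).
move=> a0 v0.
have r1 : 1 < r by rewrite /r ltr_pdivlMr; lra.
have := powR_tangent r1 (powR_ge0 a (p - 1)) v0.
move=> /(ler_wpM2r a0).
have -> : ((a `^ (p - 1)) `^ r) = a `^ (q - 1).
  by rewrite -powRrM; congr (_ `^ _); rewrite /r; field; rewrite subr_eq0 gt_eqF.
rewrite [leRHS]mulrC mulr_powRB1//; last lra.
have -> : a `^ p = a `^ (p - 1) * a by rewrite mulrC mulr_powRB1//; lra.
lra.
Qed.

(** This is Hoelder's inequality for [p] between [1] and [q].  It is obtained by
    integrating the pointwise bound [powR_interpolation] at [v = F / f], the value
    of [phi ^ (p - 1)] where [phi] is not [0] in the case of equality. *)
Lemma integral_interpolation :
  ((F `^ ((q - 1) / (p - 1)) / f `^ ((q - p) / (p - 1)))%:E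
   <= \int[mu]_x (phi x `^ q)%:E)%E.
Proof.
have [[p1 pq'] [F0 f0]] := ((p_gt1, pq), (F_gt0, f_gt0)).
pose r := (q - 1) / (p - 1); pose v := F / f.
have r1 : 1 < r by rewrite /r ltr_pdivlMr; lra.
have v0 : 0 < v by rewrite divr_gt0.
have r10 : 0 <= r - 1 by lra.
have r0 : 0 <= r by lra.
have mpow s : measurable_fun setT (fun x => phi x `^ s).
  exact: (measurableT_comp (measurable_powR s)).
have Eint c s : 0 <= c -> (\int[mu]_x (c * phi x `^ s)%:E =
    c%:E * \int[mu]_x (phi x `^ s)%:E)%E.
  move=> c0; under eq_integral do rewrite EFinM.
  rewrite ge0_integralZl//; first exact/measurable_EFinP.
  by move=> x _; rewrite lee_fin powR_ge0.
have phi1 x : phi x = phi x `^ 1 by rewrite powRr1.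
have c1 : 0 <= r * v `^ (r - 1) by rewrite mulr_ge0 ?powR_ge0.
have c2 : 0 <= (r - 1) * v `^ r by rewrite mulr_ge0 ?powR_ge0.
have : (\int[mu]_x (r * v `^ (r - 1) * phi x `^ p)%:E <=
        \int[mu]_x (phi x `^ q + (r - 1) * v `^ r * phi x `^ 1)%:E)%E.
  apply: ge0_le_integral => //.
  - by move=> x _; rewrite lee_fin mulr_ge0 ?powR_ge0.
  - by apply/measurable_EFinP; exact: measurable_funM.
  - by apply/measurable_EFinP; apply: measurable_funD => //; exact: measurable_funM.
  - by move=> x _; rewrite lee_fin -phi1 powR_interpolation.
under [X in (_ <= X)%E -> _]eq_integral do rewrite EFinD.
rewrite ge0_integralD//; last 4 first.
- by move=> x _; rewrite lee_fin powR_ge0.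
- exact/measurable_EFinP.
- by move=> x _; rewrite lee_fin mulr_ge0 ?powR_ge0.
- by apply/measurable_EFinP; exact: measurable_funM.
rewrite !Eint// int_phip.
under [X in (_ <= _ + _ * X)%E -> _]eq_integral do rewrite -phi1.
rewrite int_phi -!EFinM.
have -> : (q - p) / (p - 1) = r - 1.
  by rewrite /r; field; rewrite subr_eq0 gt_eqF.
have -> : F `^ r / f `^ (r - 1) = v `^ (r - 1) * F.
  rewrite /v powRM ?invr_ge0 ?(ltW F0) ?(ltW f0)// -[f^-1]powR_inv1 ?ltW//.
  rewrite -powRrM mulN1r powRN -(@mulr_powRB1 _ F r) ?(ltW F0)//; last lra.
  ring.
have vr : v `^ r * f = v `^ (r - 1) * F.
  rewrite -(@mulr_powRB1 _ v r) ?(ltW v0)//; last lra.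
  by rewrite mulrAC /v divfK ?gt_eqF// mulrC.
case: (\int[mu]_x _)%E => [B| |]; [|by move=> _; rewrite leey|by rewrite addNye leeNy_eq].
rewrite -EFinD !lee_fin -[_ * v `^ r * f]mulrA vr.
lra.
Qed.

End interpolation.

Lemma Bellman_ge d (X : measurableType d) (R : realType)
    (mu : probability X R) (N : nat) (T : set (set X)) (p q F f : R) :
    (1 < N)%N -> homogeneous_tree_like mu N T ->
    1 < p -> p < q -> 0 < F -> 0 < f ->
  ((f `^ q + extremal_const q N%:R *
    (F `^ ((q - 1) / (p - 1)) / f `^ ((q - p) / (p - 1)) - f `^ q))%:E
   <= Bellman mu T p q F f)%E.
Proof.
move=> N1 [C treeT] p1 pq F0 f0.
have q1 : 1 < q by lra.
have n1 : 1 < N%:R :> R by rewrite ltr1n.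
apply: le_ereal_inf_tmp => _ [phi [mphi phi0 int_phi int_phip] <-].
have K0 := extremal_const_gt0 q1 n1.
have Kstep := potential_step q1 n1.
have := maximal_estimate N1 treeT mphi phi0 int_phi q1 K0 Kstep f0.
have := integral_interpolation mphi phi0 int_phi int_phip p1 pq F0 f0.
move: (extremal_const q N%:R) K0 {Kstep} => K K0.
move: (F `^ _ / _) => G.
have : (0 <= \int[mu]_x (maximal_operator mu T phi x `^ q))%E.
  by apply: integral_ge0 => x _; exact: poweR_ge0.
case: (\int[mu]_x (maximal_operator mu T phi x `^ q))%E => [W| |]// _; last first.
  by move=> _ _; rewrite leey.
case: (\int[mu]_x _)%E => [B| |]//.
  rewrite -EFinM -!EFinD !lee_fin => /(ler_wpM2l (ltW K0)); lra.
by rewrite gt0_muley ?lte_fin.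
Qed.

(** * The extremal spike *)


Section extremal_function.
Context d (X : measurableType d) (R : realType) (mu : probability X R).
Context (N : nat) (T : set (set X)) (C : set X -> set (set X)).
Context (N_gt1 : (1 < N)%N) (treeT : tree_with_children mu N T C).
Context (f p q : R) (m : nat) (x0 : X).
Context (f_gt0 : 0 < f) (p_gt1 : 1 < p) (q_gt1 : 1 < q).

Local Notation I k := (cell C k x0).
Local Notation level := (tree_level C).

Definition spike : X -> R := fun x => f * N%:R ^+ m * \1_(I m) x.

Local Notation M := (maximal_operator mu T spike).

Let mI k : measurable (I k).
Proof. by have [/(level_measurable treeT)] := cellP treeT k x0. Qed.

Let levelI k : level k (I k). Proof. by have [] := cellP treeT k x0. Qed.

Let muI k : mu (I k) = (N%:R ^- k)%:E. Proof. exact: mu_level treeT _ _ _. Qed.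

Let N0 : 0 < N%:R :> R. Proof. by rewrite ltr0n; exact: ltn_trans N_gt1. Qed.
Let N1 : 1 < N%:R :> R. Proof. by rewrite ltr1n. Qed.

Let h_gt0 : 0 < f * N%:R ^+ m. Proof. by rewrite mulr_gt0 ?exprn_gt0. Qed.

Lemma chain_sub j k : (j <= k)%N -> I k `<=` I j.
Proof.
move=> jk; have [_ xk] := cellP treeT k x0; have [lj xj] := cellP treeT j x0.
by apply: (level_sub_ancestor treeT lj (k := k - j) _ xj xk); rewrite subnKC.
Qed.

Lemma spike_measurable : measurable_fun setT spike.
Proof. by apply: measurable_funM => //; exact: measurable_indic. Qed.

Lemma spike_ge0 x : 0 <= spike x.
Proof. by rewrite /spike mulr_ge0// ltW. Qed.

Lemma spike_le x : spike x <= f * N%:R ^+ m.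
Proof.
by rewrite /spike indicE ler_piMr ?(ltW h_gt0)//; case: (_ \in _).
Qed.

Let integral_indic_chain c k : 0 <= c ->
  (\int[mu]_x (c * \1_(I k) x)%:E = (c * N%:R ^- k)%:E)%E.
Proof.
move=> c0; under eq_integral do rewrite EFinM.
rewrite ge0_integralZl//.
  by rewrite integral_indic// setIT EFinM -muI.
by apply/measurable_EFinP; exact: measurable_indic.
Qed.

Lemma integral_spike : (\int[mu]_x (spike x)%:E)%E = f%:E.
Proof.
rewrite integral_indic_chain ?(ltW h_gt0)// mulfK//.
by rewrite expf_neq0// gt_eqF.
Qed.

Lemma integral_spike_powR :
  (\int[mu]_x (spike x `^ p)%:E)%E = ((N%:R ^+ m) `^ (p - 1) * f `^ p)%:E.
Proof.
have p0 : p != 0 by rewrite gt_eqF// (lt_trans ltr01 p_gt1).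
have -> : (fun x => (spike x `^ p)%:E) =
    (fun x => ((f * N%:R ^+ m) `^ p * \1_(I m) x)%:E).
  apply/funext => x; rewrite /spike indicE; case: (_ \in _).
    by rewrite !mulr1.
  by rewrite !mulr0 powR0.
rewrite integral_indic_chain ?powR_ge0//; congr EFin.
have Nm : 0 < N%:R ^+ m :> R by rewrite exprn_gt0.
rewrite powRM ?(ltW f_gt0) ?(ltW Nm)// powR_subr1//.
by rewrite [RHS]mulrC mulrA.
Qed.

Lemma avg_spike_le_level j J : level j J -> avg mu spike J <= f * N%:R ^+ j.
Proof.
move=> lJ; have mJ := level_measurable treeT lJ.
have := integral_phi_le spike_measurable spike_ge0 integral_spike mJ.
rewrite (integral_avg N_gt1 treeT spike_measurable spike_ge0 integral_spike lJ).
by rewrite lee_fin mulrC ler_pdivrMr// exprn_gt0.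
Qed.

Lemma avg_spike_le j J : level j J -> avg mu spike J <= f * N%:R ^+ m.
Proof.
move=> lJ; have mJ := level_measurable treeT lJ.
rewrite -(ler_pM2l (@mu_level_gt0 R N N_gt1 j)) -lee_fin.
rewrite -(integral_avg N_gt1 treeT spike_measurable spike_ge0 integral_spike lJ).
rewrite -(integral_cst_level treeT _ lJ); apply: ge0_le_integral => //.
- by move=> x _; rewrite lee_fin spike_ge0.
- apply/measurable_EFinP; apply: measurable_funS spike_measurable => //.
- by move=> x _; rewrite lee_fin spike_le.
Qed.

Lemma avg_spike_eq0 j J : level j J -> J `&` I m = set0 -> avg mu spike J = 0.
Proof.
move=> lJ JI; have mJ := level_measurable treeT lJ.
have : (\int[mu]_(x in J) (spike x)%:E = 0)%E.
  apply: integral0_eq => x Jx; rewrite /spike indicE memNset ?mulr0// => Ix.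
  by have : (J `&` I m) x by []; rewrite JI.
rewrite (integral_avg N_gt1 treeT spike_measurable spike_ge0 integral_spike lJ).
move=> [] /eqP; rewrite mulf_eq0 gt_eqF ?mu_level_gt0//= => /eqP//.
Qed.

Lemma maximal_spike_le x : (M x <= (f * N%:R ^+ m)%:E)%E.
Proof.
rewrite (maximal_operatorE N_gt1 treeT spike_measurable spike_ge0 integral_spike).
apply: ge_ereal_sup => _ [j _ <-]; rewrite lee_fin.
by have [lJ _] := cellP treeT j x; exact: avg_spike_le lJ.
Qed.

(** A tree set that contains [x] is either of level at most [k], where its
    average is at most [f * N ^ k] because the total mass is [f], or it is
    disjoint from [I k.+1] and hence from the support of the spike. *)
Lemma maximal_spike_le_outside k x : (k < m)%N -> ~ I k.+1 x ->
  (M x <= (f * N%:R ^+ k)%:E)%E.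
Proof.
move=> km nIx.
rewrite (maximal_operatorE N_gt1 treeT spike_measurable spike_ge0 integral_spike).
apply: ge_ereal_sup => _ [j _ <-]; rewrite lee_fin.
have [lJ Jx] := cellP treeT j x.
have [jk|kj] := leqP j k.
  apply: le_trans (avg_spike_le_level lJ) _.
  by rewrite ler_pM2l// ler_weXn2l// ltW.
rewrite (avg_spike_eq0 lJ); first by rewrite mulr_ge0 ?exprn_ge0// ltW.
apply/seteqP; split => // y [Jy Iy]; apply: nIx.
have Iy' := chain_sub km Iy.
apply: (level_sub_ancestor treeT (levelI k.+1) (k := j - k.+1) _ Iy' Jy) => //.
by rewrite subnKC.
Qed.

Let mMq : measurable_fun setT (fun x => M x `^ q)%E.
Proof.
apply: (measurableT_comp (measurable_poweR q)).
exact: (maximal_measurable N_gt1 treeT spike_measurable spike_ge0 integral_spike).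
Qed.

Let integral_le_cst D (c : R) : measurable D -> 0 <= c ->
  (forall x, D x -> M x <= c%:E)%E ->
  (\int[mu]_(x in D) (M x `^ q) <= (c `^ q)%:E * mu D)%E.
Proof.
move=> mD c0 Mc; rewrite -integral_cst//; apply: ge0_le_integral => //.
- by move=> x _; exact: poweR_ge0.
- exact: measurable_funS mMq.
- move=> x Dx; rewrite -poweR_EFin gt0_ler_poweR ?Mc//.
  + exact: ltW (lt_trans ltr01 q_gt1).
  + rewrite in_itv/= leey andbT.
    apply: le_trans (maximal_ge N_gt1 treeT spike_measurable spike_ge0
      integral_spike x); by rewrite lee_fin ltW.
  + by rewrite in_itv/= leey lee_fin c0.
Qed.

Local Notation w := (N%:R `^ (q - 1)).

Let w_gt1 : 1 < w.
Proof.
rewrite -(ltr_pM2l N0) mulr1 mulr_powRB1 ?(ltW N0)//.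
  exact: ltr_powR_self.
exact: lt_trans ltr01 q_gt1.
Qed.

Let height_powR k : (f * N%:R ^+ k) `^ q = f `^ q * (w ^+ k * N%:R ^+ k).
Proof.
rewrite powRM ?exprn_ge0 ?(ltW f_gt0) ?(ltW N0)//; congr (_ * _).
rewrite -[in LHS]powR_mulrn ?(ltW N0)// powRAC powR_mulrn ?powR_ge0//.
rewrite -exprMn mulrC mulr_powRB1 ?(ltW N0)//; exact: lt_trans ltr01 q_gt1.
Qed.

(** The layer between [I k] and [I k.+1] has measure [N ^- k * (1 - N^-1)], and
    there [M ^ q] is at most [(f * N ^ k) ^ q]: with [w = N ^ (q - 1)] its
    contribution is [f ^ q * (1 - N^-1) * w ^ k], the general term of a geometric
    series. *)
Lemma integral_maximal_outside k : (k <= m)%N ->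
  (\int[mu]_(x in ~` I k) (M x `^ q) <=
   (f `^ q * ((1 - N%:R^-1) * ((w ^+ k - 1) / (w - 1))))%:E)%E.
Proof.
elim: k => [_|k IH km].
  rewrite (_ : ~` _ = set0) ?integral_set0.
    by rewrite expr0 subrr mul0r !mulr0.
  by have := levelI 0 => /= ->; rewrite setCT.
have Ik := chain_sub (leqnSn k).
have -> : ~` I k.+1 = ~` I k `|` (I k `\` I k.+1).
  apply/seteqP; split => x.
    by have [|] := pselect (I k x); [right|left].
  by case=> [+ /Ik//|[]].
rewrite ge0_integral_setU//; last 5 first.
- exact: measurableC.
- exact: measurableD.
- exact: measurable_funS mMq.
- by move=> x _; exact: poweR_ge0.
- by apply/disj_setPS => x [+ []].
have mD : measurable (I k `\` I k.+1) by exact: measurableD.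
have fk0 : 0 <= f * N%:R ^+ k by rewrite mulr_ge0 ?exprn_ge0// ltW.
have := integral_le_cst mD fk0 (fun x Dx => maximal_spike_le_outside km Dx.2).
have -> : mu (I k `\` I k.+1) = (N%:R ^- k - N%:R ^- k.+1)%:E.
  have fin : (mu (I k) < +oo)%E by rewrite muI ltry.
  by rewrite measureD// (setIidr Ik) EFinB; congr (_ - _)%E; exact: muI.
rewrite -EFinM height_powR => H.
apply: le_trans (leeD (IH (ltnW km)) H) _; rewrite -EFinD lee_fin.
rewrite le_eqVlt; apply/orP; left; apply/eqP.
rewrite !exprS; have Nk : N%:R ^+ k != 0 :> R by rewrite expf_neq0 ?gt_eqF.
by field; rewrite Nk subr_eq0 !gt_eqF.
Qed.

Lemma integral_maximal_spike :
  (\int[mu]_x (M x `^ q) <=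
   (f `^ q * (1 + extremal_const q N%:R * (w ^+ m - 1)))%:E)%E.
Proof.
rewrite -(setvU (I m)) ge0_integral_setU//; last 4 first.
- exact: measurableC.
- exact: measurable_funS mMq.
- by move=> x _; exact: poweR_ge0.
- by apply/disj_setPS => x [].
have := integral_le_cst (mI m) (ltW h_gt0) (fun x _ => maximal_spike_le x).
rewrite muI -EFinM height_powR => H.
apply: le_trans (leeD (integral_maximal_outside (leqnn m)) H) _.
rewrite -EFinD lee_fin le_eqVlt; apply/orP; left; apply/eqP.
rewrite /extremal_const -(@mulr_powRB1 _ N%:R q) ?(ltW N0)//; last first.
  exact: lt_trans ltr01 q_gt1.
have Nm : N%:R ^+ m != 0 :> R by rewrite expf_neq0 ?gt_eqF.
have w10 : w - 1 != 0 by rewrite subr_eq0 gt_eqF.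
have d0 : N%:R * w - N%:R != 0.
  have -> : N%:R * w - N%:R = N%:R * (w - 1) by ring.
  by rewrite mulf_neq0// gt_eqF.
by field; rewrite Nm w10 d0 gt_eqF.
Qed.

Lemma Bellman_le :
  (Bellman mu T p q ((N%:R ^+ m) `^ (p - 1) * f `^ p) f <=
   (f `^ q * (1 + extremal_const q N%:R * (w ^+ m - 1)))%:E)%E.
Proof.
apply: le_trans integral_maximal_spike; apply: ereal_inf_lbound.
exists spike => //; split.
- exact: spike_measurable.
- exact: spike_ge0.
- exact: integral_spike.
- exact: integral_spike_powR.
Qed.

End extremal_function.

(** * The value of the Bellman function *)


(** The exponents of [f] add up: [p (q - 1) - (q - p) = q (p - 1)]. *)
Lemma power_constraint_value (R : realType) (n f p q : R) (m : nat) :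
    0 < n -> 0 < f -> 1 < p ->
  ((n ^+ m) `^ (p - 1) * f `^ p) `^ ((q - 1) / (p - 1))
    / f `^ ((q - p) / (p - 1)) = f `^ q * (n `^ (q - 1)) ^+ m.
Proof.
move=> n0 f0 p1; have p10 : p - 1 != 0 by rewrite subr_eq0 gt_eqF.
rewrite powRM ?powR_ge0// -!powRrM -mulrA -powRB; last first.
  by apply/implyP => _; rewrite gt_eqF.
rewrite mulrC; congr (f `^ _ * _); first by field.
have -> : (p - 1) * ((q - 1) / (p - 1)) = q - 1 by field.
by rewrite -powR_mulrn ?(ltW n0)// powRAC powR_mulrn ?powR_ge0.
Qed.

Lemma Bellman_power d (X : measurableType d) (R : realType)
    (mu : probability X R) (N : nat) (T : set (set X)) (p q f : R) (m : nat) :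
    (1 < N)%N -> homogeneous_tree_like mu N T -> 1 < p -> p < q -> 0 < f ->
  Bellman mu T p q ((N%:R ^+ m) `^ (p - 1) * f `^ p) f =
  (f `^ q * (1 + extremal_const q N%:R * ((N%:R `^ (q - 1)) ^+ m - 1)))%:E.
Proof.
move=> N1 hT p1 pq f0; have [C treeT] := hT.
have N0 : 0 < N%:R :> R by rewrite ltr0n (ltn_trans _ N1).
have q1 : 1 < q by lra.
have [x0 _] : exists x0 : X, setT x0.
  apply/set0P/eqP => X0; have := probability_setT mu.
  by rewrite X0 measure0 => -[] /eqP; rewrite eq_sym oner_eq0.
apply/eqP; rewrite eq_le (Bellman_le N1 treeT m x0)//=.
have F0 : 0 < (N%:R ^+ m) `^ (p - 1) * f `^ p.
  by rewrite mulr_gt0// powR_gt0// exprn_gt0.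
apply: le_trans (Bellman_ge N1 hT p1 pq F0 f0).
rewrite power_constraint_value// lee_fin le_eqVlt; apply/orP; left; apply/eqP.
by move: (extremal_const _ _) => K; ring.
Qed.

Theorem theorem2 (R : realType) (d : measure_display) (X : measurableType d)
    (mu : probability X R) (N : nat) (T : set (set X)) (p q F f : R)
    (hN : (1 < N)%N) (hmu : nonatomic mu) (hT : homogeneous_tree_like mu N T)
    (hp : 1 < p) (hq : p < q) (hF : 0 < F) (hf : 0 < f) (hfF : f `^ p <= F) :
  let K := (N%:R `^ q - 1) / (N%:R `^ q - N%:R) in
  let L := f `^ q + K * (F `^ ((q - 1) / (p - 1)) / f `^ ((q - p) / (p - 1))
                         - f `^ q) in
  [/\ (L%:E <= Bellman mu T p q F f)%E,
      (forall m : nat, (F / f `^ p) `^ (p - 1)^-1 = N%:R ^+ m ->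
         Bellman mu T p q F f = L%:E)
    & forall m : nat,
        Bellman mu T p q (N%:R `^ (m%:R * (p - 1)) * f `^ p) f =
        (f `^ q * (1 + K * (N%:R `^ (m%:R * (q - 1)) - 1)))%:E].
Proof.
have n0 : 0 < N%:R :> R by rewrite ltr0n (ltn_trans _ hN).
move=> K L; split.
- exact: (Bellman_ge hN hT hp hq hF hf).
- move=> m Fm.
  have FE : F = (N%:R ^+ m) `^ (p - 1) * f `^ p.
    have p10 : p - 1 != 0 by rewrite subr_eq0 gt_eqF.
    rewrite -Fm -powRrM mulVf// powRr1; last by rewrite divr_ge0 ?powR_ge0// ltW.
    by rewrite divfK// gt_eqF// powR_gt0.
  rewrite /L FE Bellman_power// power_constraint_value//.
  congr EFin; rewrite -[K]/(extremal_const q N%:R).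
  by move: (extremal_const _ _) => k; ring.
- move=> m; have powE s : N%:R `^ (m%:R * s) = (N%:R ^+ m) `^ s :> R.
    by rewrite powRrM powR_mulrn// ltW.
  rewrite !powE Bellman_power//; congr (_ * (1 + _ * (_ - _)))%:E.
  by rewrite -[in RHS]powR_mulrn ?(ltW n0)// powRAC powR_mulrn ?powR_ge0.
Qed.
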